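(* Let $A,B$ be real symmetric $n\times n$ matrices such that $B$ is strictly copositive. Then the homogeneous quadratic program $$(HQP)\quad \min\{x^TAx : x\in\mathbb{R}^n_+,\ x^TBx\le 1\}$$ is strongly convexifiable, i.e. the set $$\{(x^TBx-1,\ x^TAx) : x\in\mathbb{R}^n_+\}+\mathbb{R}^2_+$$ is closed and convex.
   Context: A symmetric $n\times n$ matrix $Q$ is strictly copositive if $x^TQx>0$ for all $x\in\mathbb{R}^n_+\setminus\{0\}$, where $\mathbb{R}^n_+$ is the nonnegative orthant. A problem $\inf\{f(x): x\in\mathbb{R}^n_+,\ g_i(x)\le 0,\ i=0,\dots,m\}$ with $f,g_0,\dots,g_m$ quadratic functions is called strongly convexifiable if the set $\{(g_0(x),\dots,g_m(x),f(x)):x\in\mathbb{R}^n_+\}+\mathbb{R}^{m+2}_+$ is closed and convex; for (HQP), $m=0$, $g_0(x)=x^TBx-1$ and $f(x)=x^TAx$. *)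

(* Defs.v *)
From HB Require Import structures.
From mathcomp Require Export all_boot all_order all_algebra.
From mathcomp Require Export boolp classical_sets reals topology convex.
From mathcomp Require Export normedtype.

Set Implicit Arguments.
Unset Strict Implicit.
Unset Printing Implicit Defensive.

Import Order.TTheory GRing.Theory Num.Theory.
Import numFieldNormedType.Exports.

Local Open Scope classical_set_scope.
Local Open Scope ring_scope.

Definition nonneg_orthant (R : realType) (n : nat) : set 'cV[R]_n :=
  [set x | forall i, 0 <= x i ord0].

Definition qform (R : realType) (n : nat) (Q : 'M[R]_n) (x : 'cV[R]_n) : R :=
  (x^T *m Q *m x) ord0 ord0.

(* Symmetry of Q is not included; it is to be assumed separately. *)
Definition strictly_copositive (R : realType) (n : nat) (Q : 'M[R]_n) : Prop :=
  forall x : 'cV[R]_n, nonneg_orthant x -> x != 0 -> 0 < qform Q x.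

Definition minkowski_sum (R : realType) (n : nat) (S T : set 'cV[R]_n) :
  set 'cV[R]_n := [set s + t | s in S & t in T].

(* Symmetry of quad_mx is not required: replacing quad_mx by its symmetric part
   does not change the function, so the class of functions is the same. *)
Record quad_fun (R : realType) (n : nat) := QuadFun {
  quad_mx : 'M[R]_n;
  lin_vec : 'cV[R]_n;
  cst_term : R
}.

Definition quad_eval (R : realType) (n : nat) (q : quad_fun R n)
    (x : 'cV[R]_n) : R :=
  qform (quad_mx q) x + ((lin_vec q)^T *m x) ord0 ord0 + cst_term q.

(* inf { objective x | x >= 0, constraint i x <= 0 for i = 0, ..., m } *)
Record quad_problem (R : realType) (n m : nat) := QuadProblem {
  objective : quad_fun R n;
  constraint : 'I_m.+1 -> quad_fun R n
}.

(* The column (g_0(x), ..., g_m(x), f(x)) of R^(m+2). *)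
Definition problem_map (R : realType) (n m : nat) (P : quad_problem R n m)
    (x : 'cV[R]_n) : 'cV[R]_(m.+1 + 1) :=
  col_mx (\col_(i < m.+1) quad_eval (constraint P i) x)
         (quad_eval (objective P) x)%:M.

Definition strongly_convexifiable (R : realType) (n m : nat)
    (P : quad_problem R n m) : Prop :=
  let S := minkowski_sum (problem_map P @` @nonneg_orthant R n)
                         (@nonneg_orthant R (m.+1 + 1)) in
  closed S /\ convex_set S.

Definition HQP (R : realType) (n : nat) (A B : 'M[R]_n) : quad_problem R n 0 :=
  QuadProblem (QuadFun A 0 0) (fun=> QuadFun B 0 (-1)).

Lemma HQP_mapE (R : realType) (n : nat) (A B : 'M[R]_n) (x : 'cV[R]_n) :
  problem_map (HQP A B) x = col_mx (qform B x - 1)%:M (qform A x)%:M.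
Proof.
rewrite /problem_map /quad_eval /= trmx0 mul0mx mxE !addr0; congr col_mx.
by apply/matrixP => i j; rewrite !ord1 [LHS]mxE [RHS]mxE mulr1n.
Qed.

(* Main.v *)
(* Let m be the minimum of (HQP). Then m <= 0, because x = 0 is feasible, and
   by homogeneity qform A x >= m * qform B x on the orthant. Hence the set in
   question is { (s, t) | s + 1 >= 0, t >= m * (s + 1) }, an intersection of two
   closed half-planes: for the inclusion of the half-planes, scale a minimizer
   by sqrt (s + 1). The minimum exists because, when some value of qform A is
   negative, it is the minimum of qform A / qform B over the standard simplex. *)
Require Import Defs.
From mathcomp Require Import lra interval_inference function_spaces derive.

Set Implicit Arguments.
Unset Strict Implicit.
Unset Printing Implicit Defensive.

Import Order.TTheory GRing.Theory Num.Theory.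
Import numFieldNormedType.Exports.

Local Open Scope classical_set_scope.
Local Open Scope ring_scope.

Lemma qformZ (R : realType) (n : nat) (Q : 'M[R]_n) (a : R) (x : 'cV[R]_n) :
  qform Q (a *: x) = a ^+ 2 * qform Q x.
Proof.
have xT : (a *: x)^T = a *: x^T by exact: linearZ.
by rewrite /qform xT -scalemxAr -!scalemxAl scalerA mxE expr2.
Qed.

Lemma qform0 (R : realType) (n : nat) (Q : 'M[R]_n) : qform Q 0 = 0.
Proof. by rewrite /qform mulmx0 mxE. Qed.

Lemma nonneg_orthantZ (R : realType) (n : nat) (a : R) (x : 'cV[R]_n) :
  0 <= a -> nonneg_orthant x -> nonneg_orthant (a *: x).
Proof. by move=> a0 x0 i; rewrite mxE mulr_ge0. Qed.

Lemma strictly_copositive_ge0 (R : realType) (n : nat) (Q : 'M[R]_n)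
    (x : 'cV[R]_n) :
  strictly_copositive Q -> nonneg_orthant x -> 0 <= qform Q x.
Proof.
by move=> Q_cop x0; have [->|/(Q_cop x x0)/ltW//] := eqVneq x 0; rewrite qform0.
Qed.

(** Phrased on row vectors because [rV_compact] and [EVT_min_rV], used below, concern ['rV]. *)
Lemma continuous_qform_tr (R : realType) (n : nat) (Q : 'M[R]_n) :
  continuous (fun v : 'rV[R]_n => qform Q v^T).
Proof.
have -> : (fun v : 'rV[R]_n => qform Q v^T) =
    fun v => \sum_j (\sum_i v ord0 i * Q i j) * v ord0 j.
  apply/funext => v; rewrite /qform trmxK mxE; apply: eq_bigr => j _.
  by rewrite !mxE.
apply: continuous_big => [|j _ v]; first exact: add_continuous.
apply: continuousM; last exact: coord_continuous.
apply: continuous_big => [|i _ w]; first exact: add_continuous.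
by apply: continuousM; [exact: coord_continuous|exact: cst_continuous].
Qed.

Definition row_simplex (R : realType) (n : nat) : set 'rV[R]_n :=
  [set v | (forall i, 0 <= v ord0 i) /\ \sum_i v ord0 i = 1].

(** The simplex is a closed hyperplane section of the compact cube with sides [[0, 1]]: a coordinate
    is at most the sum, the others being nonnegative. *)
Lemma compact_row_simplex (R : realType) (n : nat) :
  compact (@row_simplex R n).
Proof.
have cube_compact := @rV_compact R n (fun=> `[0, 1]%classic)
  (fun=> @segment_compact R 0 1).
pose cube : set 'rV[R]_n := [set v | forall i, `[0, 1]%classic (v ord0 i)].
pose sum1 := (fun v : 'rV[R]_n => \sum_i v ord0 i) @^-1` [set x | x = 1].
have -> : @row_simplex R n = sum1 `&` cube.
  apply/seteqP; split=> v /= [].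
    move=> v0 v1; split=> // i; rewrite /= in_itv /= v0 -v1 (bigD1 i) //= lerDl.
    exact: sumr_ge0.
  move=> v1 v01; split=> // i.
  by have /= := v01 i; rewrite in_itv /= => /andP[].
apply: (subclosed_compact _ cube_compact); last by move=> v [].
apply: closedI; last exact: compact_closed (@norm_hausdorff _ _) cube_compact.
apply: preimage_closed; last exact: closed_eq.
move=> v _; apply: continuous_big => [|i _]; first exact: add_continuous.
exact: coord_continuous.
Qed.

(** The factor is the coordinate sum, which vanishes on the orthant only at the origin. *)
Lemma scale_row_simplex (R : realType) (n : nat) (x : 'cV[R]_n) :
  nonneg_orthant x -> x != 0 ->
  exists a (v : 'rV[R]_n), [/\ 0 < a, row_simplex v & x = a *: v^T].
Proof.
move=> x0 xn0; pose a := \sum_i x i ord0.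
have a_gt0 : 0 < a.
  rewrite lt_neqAle sumr_ge0 ?andbT => [|i _]; last exact: x0.
  apply: contra xn0 => /eqP/esym a0; apply/eqP/matrixP => i j.
  rewrite ord1 mxE; apply: (psumr_eq0P _ a0) => // k _; exact: x0.
exists a, (a^-1 *: x^T); split=> //; last first.
  by rewrite linearZ /= trmxK scalerA mulfV ?scale1r ?gt_eqF.
split=> [i|]; first by rewrite !mxE mulr_ge0 ?x0 // invr_ge0 ltW.
under eq_bigr do rewrite !mxE.
by rewrite -mulr_sumr mulVf ?gt_eqF.
Qed.

Lemma row_simplex_orthant (R : realType) (n : nat) (v : 'rV[R]_n) :
  row_simplex v -> nonneg_orthant v^T /\ v^T != 0.
Proof.
move=> [v0 v1]; split=> [i|]; first by rewrite mxE.
apply/eqP => vT0; have := @oner_neq0 R; rewrite -v1 big1 ?eqxx // => i _.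
by have /matrixP/(_ i ord0) := vT0; rewrite !mxE.
Qed.

Lemma HQP_min (R : realType) (n : nat) (A B : 'M[R]_n) :
  strictly_copositive B ->
  exists (m : R) (z : 'cV[R]_n),
    [/\ m <= 0, nonneg_orthant z, qform B z <= 1, qform A z = m &
        forall x, nonneg_orthant x -> m * qform B x <= qform A x].
Proof.
move=> B_cop.
have B_simplex v : row_simplex v -> 0 < qform B v^T.
  by move=> /row_simplex_orthant[]; exact: B_cop.
have [A_ge0|] := pselect (forall x, nonneg_orthant x -> 0 <= qform A x).
  exists 0, 0; rewrite !qform0; split=> // [i|x x0]; first by rewrite mxE.
  by rewrite mul0r; exact: A_ge0.
move=> /existsNP[w /not_implyP[w0 /negP]]; rewrite -ltNge => Aw_lt0.
have wn0 : w != 0 by apply: contraTneq Aw_lt0 => ->; rewrite qform0 ltxx.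
(* [u] shows that the simplex is nonempty, as the extreme value theorem requires; it is empty for
   [n = 0]. *)
have [_ [u [_ su _]]] := scale_row_simplex w0 wn0.
have [] := @EVT_min_rV R n (fun v => qform A v^T / qform B v^T) (@row_simplex R n).
- by exists u.
- exact: compact_row_simplex.
(* Continuity is checked at points of the simplex only, where the denominator is positive. *)
- apply: continuous_in_subspaceT => v /set_mem sv.
  apply: (@continuousM R _ (fun v => qform A v^T) (fun v => (qform B v^T)^-1) v).
    exact: continuous_qform_tr.
  apply: continuousV; first by rewrite gt_eqF ?B_simplex.
  exact: continuous_qform_tr.
move=> c /set_mem sc c_min; set m := qform A c^T / qform B c^T in c_min.
have m_min x : nonneg_orthant x -> m * qform B x <= qform A x.
  move=> x0; have [->|xn0] := eqVneq x 0; first by rewrite !qform0 mulr0.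
  have [a [v [a0 sv ->]]] := scale_row_simplex x0 xn0.
  (* Both sides carry the factor [a ^+ 2]; cancelling it leaves the minimality of the ratio at
     [c]. *)
  rewrite !qformZ mulrCA ler_pM2l ?exprn_gt0 // -ler_pdivlMr ?B_simplex //.
  exact/c_min/mem_set.
have m0 : m <= 0.
  by rewrite -(pmulr_lle0 _ (B_cop w w0 wn0)) (le_trans (m_min w w0)) ?ltW.
have Bc := B_simplex c sc.
have norm_c : (Num.sqrt (qform B c^T))^-1 ^+ 2 = (qform B c^T)^-1.
  by rewrite exprVn sqr_sqrtr // ltW.
(* Normalizing [c] so that [qform B] is 1 turns the ratio into the value of [qform A]. *)
exists m, ((Num.sqrt (qform B c^T))^-1 *: c^T); split=> //.
- apply: nonneg_orthantZ; first by rewrite invr_ge0 sqrtr_ge0.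
  by case: (row_simplex_orthant sc).
- by rewrite qformZ norm_c mulVf ?gt_eqF.
- by rewrite qformZ norm_c mulrC.
Qed.

Lemma HQP_sumE (R : realType) (n : nat) (A B : 'M[R]_n) :
  strictly_copositive B ->
  exists m : R,
    minkowski_sum (problem_map (HQP A B) @` @nonneg_orthant R n)
                  (@nonneg_orthant R (1 + 1)) =
    [set y : 'cV[R]_(1 + 1) | 0 <= y (lshift 1 ord0) ord0 + 1 /\
                             m * (y (lshift 1 ord0) ord0 + 1) <= y (rshift 1 ord0) ord0].
Proof.
move=> B_cop; have [m [z [m0 z0 Bz Az m_min]]] := HQP_min A B_cop.
exists m; apply/seteqP; split=> [_ [_ [x x0 <-] [t t0 <-]]|y [y0 y1]] /=.
  rewrite HQP_mapE !mxE (unsplitK (inl ord0)) (unsplitK (inr ord0)) !mxE !mulr1n.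
  have := t0 (lshift 1 ord0); have := t0 (rshift 1 ord0).
  have := strictly_copositive_ge0 B_cop x0; have := m_min x x0.
  set t1 := t _ _; set t2 := t _ _; move=> h1 h2 h3 h4; split; first by lra.
  (* The slack added to the first coordinate is multiplied by [m <= 0], so it can only lower the
     left-hand side. *)
  by nra.
set u := y (lshift 1 ord0) ord0 + 1 in y0 y1.
(* With this scaling [qform B x <= u] and [qform A x = m * u], so [y] dominates the image of [x] in
   both coordinates. *)
pose x := Num.sqrt u *: z.
have Bx : qform B x = u * qform B z by rewrite qformZ sqr_sqrtr.
have Ax : qform A x = u * m by rewrite qformZ sqr_sqrtr // Az.
exists (problem_map (HQP A B) x).
  by exists x => //; apply: nonneg_orthantZ; rewrite ?sqrtr_ge0.
exists (y - problem_map (HQP A B) x); last by rewrite addrC subrK.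
move=> i; rewrite HQP_mapE -(splitK i).
case: (split i) => j; rewrite (ord1 j) !mxE unsplitK !mxE mulr1n subr_ge0.
  by rewrite Bx lerBlDr ler_piMr.
by rewrite Ax mulrC.
Qed.

Theorem proposition2p1 (R : realType) (n : nat) (A B : 'M[R]_n)
    (A_sym : A^T = A) (B_sym : B^T = B) (B_cop : strictly_copositive B) :
  strongly_convexifiable (HQP A B).
Proof.
have [m SE] := HQP_sumE A B_cop.
rewrite /strongly_convexifiable /= SE; split.
  (* Each half-plane is the preimage of the nonnegative reals under a continuous affine function. *)
  have closed_nonneg (f : 'cV[R]_(1 + 1) -> R) :
      continuous f -> closed [set y | 0 <= f y].
    by move=> cf; apply: (preimage_closed _ (@closed_ge R 0)) => y _; exact: cf.
  under eq_set => y do rewrite -[_ * _ <= _]subr_ge0.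
  apply: closedI; apply: closed_nonneg => y.
    by apply: continuousD; [exact: coord_continuous|exact: cst_continuous].
  apply: (@continuousB R R^o _ (fun y : 'cV[R]_(1 + 1) => y (rshift 1 ord0) ord0)
    (fun y => m * (y (lshift 1 ord0) ord0 + 1))).
    exact: coord_continuous.
  apply: continuousM; first exact: cst_continuous.
  by apply: continuousD; [exact: coord_continuous|exact: cst_continuous].
move=> x y l /set_mem[/= x0 x1] /set_mem[/= y0 y1]; apply/mem_set => /=.
rewrite !mxE.
have l0 : 0 <= l%:num by [].
have l1 : l%:num <= 1 by [].
(* Both inequalities are affine in the point, so they survive averaging with the nonnegative weights
   [l] and [1 - l]. *)
rewrite /unstable.onem; nra.
Qed.
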